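(* For every digraph $D$ there is a constant $C_D>0$ such that for every restriction vector $\mathbf{r}$, writing $M=\max_v\mathbf{r}_v$, \[\max_{v\in V(D)}\Big\{\sum_{u\in N^+(v)}\mathbf{r}_u-\sum_{u\in N^-(v)}\mathbf{r}_u\Big\}\le S_D(\mathbf{r})\le \max_{v\in V(D)}\Big\{\sum_{u\in N^+(v)}\mathbf{r}_u-\sum_{u\in N^-(v)}\mathbf{r}_u\Big\}+C_D M^{2/3}.\]
   Context: A digraph $D$ has a finite vertex set $V(D)$ and a set $E(D)$ of ordered pairs of distinct vertices (arcs), with at most one arc between any pair of vertices. $N^+(v)=\{u:vu\in E(D)\}$, $N^-(v)=\{u:uv\in E(D)\}$. A restriction vector is a vector $\mathbf{r}$ of nonnegative integers indexed by $V(D)$; $\operatorname{supp}(\mathbf{r})=\{v:\mathbf{r}_v>0\}$; $\delta_v$ is the indicator vector of $v$. Semi-restricted $D$-game with parameter $\mathbf{r}$: two players, Rei and Norman, play $\sum_u\mathbf{r}_u$ rounds; in each round both simultaneously choose a vertex, Rei being required to choose each $u$ exactly $\mathbf{r}_u$ times overall, Norman unrestricted. A strategy for Norman is a function $\mathcal{N}$ assigning to each restriction vector a random variable with values in $V(D)$; a strategy for Rei is a function $\mathcal{R}$ assigning to each restriction vector $\mathbf{r}$ a random variable with values in $\operatorname{supp}(\mathbf{r})$ (choices are independent across players and rounds). The score for Norman is defined recursively: $0$ if $\mathbf{r}=0$; otherwise with $x=\mathcal{N}(\mathbf{r})$, $y=\mathcal{R}(\mathbf{r})$, Norman gains $+1$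 if $y\in N^+(x)$, $-1$ if $y\in N^-(x)$, $0$ otherwise, and play continues from $\mathbf{r}-\delta_y$. $S_D(\mathbf{r};\mathcal{N},\mathcal{R})$ is the expected score, $S_D(\mathbf{r};\mathcal{R})=\max_{\mathcal{N}}S_D(\mathbf{r};\mathcal{N},\mathcal{R})$, and $S_D(\mathbf{r})=\min_{\mathcal{R}}S_D(\mathbf{r};\mathcal{R})$. *)

(* Defs.v *)
From HB Require Import structures.
From mathcomp Require Import all_boot all_order all_algebra.
From mathcomp Require Import all_classical all_reals all_analysis.
Set Implicit Arguments.
Unset Strict Implicit.
Unset Printing Implicit Defensive.
Import Order.TTheory GRing.Theory Num.Theory.
Import numFieldNormedType.Exports.

Local Open Scope classical_set_scope.
Local Open Scope ring_scope.

Record digraph := Digraph {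
  vertex :> finType;
  arc : rel vertex;
  arc_irrefl : forall v, ~~ arc v v;
  arc_asym : forall u v, arc u v -> ~~ arc v u }.

Definition outn (D : digraph) (v : D) : {set D} := [set u | arc v u]%SET.
Definition inn (D : digraph) (v : D) : {set D} := [set u | arc u v]%SET.

Definition restriction (D : digraph) := {ffun D -> nat}.

Definition supp (D : digraph) (r : restriction D) : {set D} :=
  [set v | (0 < r v)%N]%SET.

Definition rounds (D : digraph) (r : restriction D) : nat := (\sum_u r u)%N.

(* [r - delta_y]; the subtraction truncates only when [y] is outside [supp r],
   which has probability [0] under a strategy for Rei *)
Definition remove (D : digraph) (r : restriction D) (y : D) : restriction D :=
  [ffun u => (r u - (u == y))%N].

Definition is_pmf (R : realType) (D : digraph) (p : D -> R) : Prop :=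
  (forall x, 0 <= p x) /\ \sum_x p x = 1.

(* The random choice made at [r] is given by its law. For Rei, no law supported
   in [supp r] exists when [supp r] is empty, so nothing is required there; no
   round is played from that vector. *)
Definition norman_strategy (R : realType) (D : digraph)
    (N : restriction D -> D -> R) : Prop :=
  forall r, is_pmf (N r).

Definition rei_strategy (R : realType) (D : digraph)
    (Q : restriction D -> D -> R) : Prop :=
  forall r, supp r != finset.set0 ->
    is_pmf (Q r) /\ forall y, y \notin supp r -> Q r y = 0.

Definition gain (R : realType) (D : digraph) (x y : D) : R :=
  if y \in outn x then 1 else if y \in inn x then - 1 else 0.

(* A play is the sequence of pairs (Norman's choice, Rei's choice). *)
Definition score (R : realType) (D : digraph) (h : seq (D * D)) : R :=
  \sum_(xy <- h) gain R xy.1 xy.2.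

Fixpoint play_prob (R : realType) (D : digraph) (N Q : restriction D -> D -> R)
    (r : restriction D) (h : seq (D * D)) : R :=
  if h is xy :: h' then
    N r xy.1 * Q r xy.2 * play_prob N Q (remove r xy.2) h'
  else 1.

Definition expected_score (R : realType) (D : digraph) (r : restriction D)
    (N Q : restriction D -> D -> R) : R :=
  \sum_(h : (rounds r).-tuple (D * D)) play_prob N Q r h * score R h.

Definition best_score (R : realType) (D : digraph) (r : restriction D)
    (Q : restriction D -> D -> R) : R :=
  sup [set expected_score r N Q | N in @norman_strategy R D].

Definition game_value (R : realType) (D : digraph) (r : restriction D) : R :=
  inf [set best_score r Q | Q in @rei_strategy R D].

(* Norman's score when he plays [v] in every round *)
Definition constant_score (R : realType) (D : digraph) (r : restriction D)
    (v : D) : R :=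
  \sum_(u in outn v) (r u)%:R - \sum_(u in inn v) (r u)%:R.

(* When [D] has a vertex, the supremum and the infimum above are a maximum and
   a minimum: see [best_score_max] and [game_value_min]. When it has none, there
   is only the empty restriction vector and all these quantities are [0]. *)

Section Attained.
Context (R : realType) (D : digraph).
Implicit Types (r : restriction D) (N Q : restriction D -> D -> R).

Lemma pmf_le1 (p : D -> R) x : is_pmf p -> p x <= 1.
Proof.
move=> [p0 <-]; rewrite (bigD1 x) //= lerDl sumr_ge0 //.
Qed.

Lemma rounds_supp0 r : supp r = finset.set0 -> rounds r = 0%N.
Proof.
move=> r0; apply: big1 => u _; apply/eqP; rewrite -leqn0 leqNgt.
by apply/negP => ru; have := finset.in_set0 u; rewrite -r0 finset.inE ru.
Qed.

Lemma rounds_remove r y : (rounds r <= (rounds (remove r y)).+1)%N.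
Proof.
rewrite /rounds (bigD1 y) //= [X in (_ <= X.+1)%N](bigD1 y) //= ffunE eqxx.
rewrite [X in (_ <= (_ + X).+1)%N](eq_bigr r) => [|u /negPf uy].
  by rewrite -addSn leq_add2r subn1; case: (r y).
by rewrite ffunE uy subn0.
Qed.

Lemma supp_neq0 r n : (n < rounds r)%N -> supp r != finset.set0.
Proof. by move=> nr; apply/eqP => /rounds_supp0 r0; rewrite r0 in nr. Qed.

Lemma eq_play_prob N Q Q' r h :
  (forall r', supp r' != finset.set0 -> Q r' =1 Q' r') ->
  (size h <= rounds r)%N -> play_prob N Q r h = play_prob N Q' r h.
Proof.
move=> QQ'; elim: h r => //= -[x y] h IH r hr /=.
rewrite QQ' ?(supp_neq0 hr) // IH // -ltnS.
exact: leq_trans hr (rounds_remove _ _).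
Qed.

Lemma play_prob_le1 N Q r h : norman_strategy N -> rei_strategy Q ->
  (size h <= rounds r)%N -> `|play_prob N Q r h| <= 1.
Proof.
move=> sN sQ; elim: h r => [|[x y] h IH] r /= hr; first by rewrite normr1.
have [sQr _] := sQ _ (supp_neq0 hr).
rewrite !normrM mulr_ile1 ?normr_ge0 ?mulr_ge0 //; last first.
  by apply: IH; rewrite -ltnS; exact: leq_trans hr (rounds_remove _ _).
rewrite mulr_ile1 ?normr_ge0 // ger0_norm ?pmf_le1 //.
- by case: (sN r).
- by case: sQr.
Qed.

Definition score_bound r : R :=
  \sum_(h : (rounds r).-tuple (D * D)) `|score R h|.

Lemma expected_score_bound r N Q : norman_strategy N -> rei_strategy Q ->
  `|expected_score r N Q| <= score_bound r.
Proof.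
move=> sN sQ; apply: le_trans (ler_norm_sum _ _ _) _.
apply: ler_sum => h _; rewrite normrM ler_piMl //.
by apply: play_prob_le1; rewrite ?size_tuple.
Qed.

Let choices : topologicalType :=
  prod_topology (fun _ : restriction D * D => R).
Let strat (f : choices) : restriction D -> D -> R := fun r x => f (r, x).
Let unstrat N : choices := fun rx => N rx.1 rx.2.

Let ev_continuous rx : continuous (fun f : choices => f rx).
Proof. exact: (@proj_continuous _ (fun=> R)). Qed.

Let sum_cont (T : topologicalType) (I : finType) (F : I -> T -> R) :
  (forall i, continuous (F i)) -> continuous (fun t => \sum_i F i t).
Proof.
move=> cF; apply: (@continuous_big _ _ +%R 0 predT) => //.
by move=> x; exact: add_continuous.
Qed.

Let mul_cont (T : topologicalType) (f g : T -> R) :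
  continuous f -> continuous g -> continuous (fun t => f t * g t).
Proof. by move=> cf cg t; apply: cvgM; [exact: cf|exact: cg]. Qed.

Let cst_cont (T : topologicalType) (c : R) : continuous (fun _ : T => c).
Proof. by move=> t; exact: cvg_cst. Qed.

Let play_prob_contN Q r h :
  continuous (fun f : choices => play_prob (strat f) Q r h).
Proof.
elim: h r => [|[x y] h IH] r /=; first exact: cst_cont.
apply: mul_cont (IH _); apply: mul_cont; last exact: cst_cont.
exact: ev_continuous.
Qed.

Let play_prob_contQ N r h :
  continuous (fun f : choices => play_prob N (strat f) r h).
Proof.
elim: h r => [|[x y] h IH] r /=; first exact: cst_cont.
apply: mul_cont (IH _); apply: mul_cont; first exact: cst_cont.
exact: ev_continuous.
Qed.

Let pmf_closed r : closed [set f : choices | is_pmf (strat f r)].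
Proof.
have -> : [set f : choices | is_pmf (strat f r)] =
    (\bigcap_(x : D) [set f : choices | 0 <= f (r, x)]) `&`
    [set f : choices | \sum_x f (r, x) = 1].
  apply/seteqP; split=> f /= [f0 f1]; split=> //; first by move=> x _; exact: f0.
  by move=> x; exact: f0.
apply: closedI.
  apply: closed_bigI => x _; apply: (preimage_closed _ (@closed_ge R 0)) => f _.
  exact: ev_continuous.
apply: (preimage_closed _ (@closed_eq R 1)) => f _.
by apply: sum_cont => x; exact: ev_continuous.
Qed.

Let unit_compact : compact [set f : choices | forall rx, 0 <= f rx <= 1].
Proof.
have -> : [set f : choices | forall rx, 0 <= f rx <= 1] =
    [set f : choices | forall rx, [set` `[0%R : R, 1%R]] (f rx)].
  by apply/seteqP; split=> f /= f01 rx; have := f01 rx; rewrite in_itv.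
apply: (@tychonoff _ (fun=> R) (fun=> [set` `[0%R : R, 1%R]])) => rx.
exact: segment_compact.
Qed.

Let norman_compact : compact [set f : choices | norman_strategy (strat f)].
Proof.
apply: (subclosed_compact _ unit_compact).
  have -> : [set f : choices | norman_strategy (strat f)] =
      \bigcap_(r : restriction D) [set f : choices | is_pmf (strat f r)].
    by apply/seteqP; split=> f /= sf r => [_|]; exact: sf.
  by apply: closed_bigI => r _; exact: pmf_closed.
move=> f /= sf [r x] /=.
by have [f0 _] := sf r; rewrite (f0 x) (pmf_le1 x (sf r)).
Qed.

(* Strategies for Rei, normalised to [0] where they are unconstrained. *)
Let rei0 : set choices := [set f | rei_strategy (strat f) /\
  forall r, supp r = finset.set0 -> forall x, f (r, x) = 0].

Let rei0_compact : compact rei0.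
Proof.
apply: (subclosed_compact _ unit_compact).
  have -> : rei0 =
      (\bigcap_(r in [set r | supp r != finset.set0])
         [set f : choices | is_pmf (strat f r)]) `&`
      (\bigcap_(rx in [set rx : restriction D * D | rx.2 \notin supp rx.1])
         [set f : choices | f rx = 0]).
    apply/seteqP; split=> f /= [].
    - move=> sf f0; split=> [r /sf[]//|[r x]] /= xr.
      by have [/f0 //|/sf[_]] := eqVneq (supp r) finset.set0; apply.
    - move=> sf f0; split=> [r r0|r r0 x]; last first.
        by apply: (f0 (r, x)) => /=; rewrite r0 finset.inE.
      by split=> [|y yr]; [exact: sf|exact: (f0 (r, y))].
  apply: closedI; first by apply: closed_bigI => r _; exact: pmf_closed.
  apply: closed_bigI => rx _.
  by apply: (preimage_closed _ (@closed_eq R 0)) => f _; exact: ev_continuous.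
move=> f [sf f0] [r x] /=.
have [r0|/sf[pf _]] := eqVneq (supp r) finset.set0.
  by rewrite f0 // lexx ler01.
by case: (pf) => fx _; rewrite (fx x) (pmf_le1 x pf).
Qed.

Let dirac_pmf (v : D) : is_pmf (fun x => (x == v)%:R : R).
Proof.
split=> [x|]; first exact: ler0n.
by rewrite (bigD1 v) //= eqxx big1 ?addr0 // => i /negPf ->.
Qed.

Let ex_norman (v : D) : norman_strategy (fun _ x => (x == v)%:R : R).
Proof. by move=> r; exact: dirac_pmf. Qed.

Lemma best_score_max r Q : (0 < #|D|)%N ->
  exists2 N, norman_strategy N & best_score r Q = expected_score r N Q.
Proof.
move=> /card_gt0P[v _].
have [||f|f sf maxf] := @compact_EVT_max choices R
    (fun f => expected_score r (strat f) Q)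
    [set f : choices | norman_strategy (strat f)].
- by exists (unstrat (fun _ x => (x == v)%:R)); exact: ex_norman.
- exact: norman_compact.
- apply: continuous_subspaceT => {}f; apply: sum_cont => h.
  by apply: mul_cont; [exact: play_prob_contN|exact: cst_cont].
have sfN : norman_strategy (strat f) by exact: set_mem sf.
exists (strat f) => //; apply/eqP; rewrite eq_le; apply/andP; split.
  apply: ge_sup => [|_ [N sN <-]].
    by exists (expected_score r (strat f) Q), (strat f).
  by apply: (maxf (unstrat N)); exact: mem_set.
apply: ub_le_sup; last by exists (strat f).
exists (expected_score r (strat f) Q) => _ [N sN <-].
by apply: (maxf (unstrat N)); exact: mem_set.
Qed.

Let eq_best_score r Q Q' :
  (forall r', supp r' != finset.set0 -> Q r' =1 Q' r') ->
  best_score r Q = best_score r Q'.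
Proof.
move=> QQ'; rewrite /best_score; congr (sup _); apply: eq_imagel => N _.
by apply: eq_bigr => h _; rewrite (eq_play_prob N QQ') // size_tuple.
Qed.

Let best_score_ub r Q : rei_strategy Q ->
  has_ubound [set expected_score r N Q | N in @norman_strategy R D].
Proof.
move=> sQ; exists (score_bound r) => _ [N sN <-].
exact: le_trans (ler_norm _) (expected_score_bound r sN sQ).
Qed.

Let best_score_lb r : (0 < #|D|)%N ->
  has_lbound [set best_score r Q | Q in @rei_strategy R D].
Proof.
move=> /card_gt0P[v _]; exists (- score_bound r) => _ [Q sQ <-].
apply: (@le_trans _ _ (expected_score r (fun _ x => (x == v)%:R) Q)).
  rewrite lerNl; apply: le_trans (ler_norm _) _; rewrite normrN.
  by apply: expected_score_bound => //; exact: ex_norman.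
apply: ub_le_sup; first exact: best_score_ub.
by exists (fun _ x => (x == v)%:R) => //; exact: ex_norman.
Qed.

Lemma ex_rei : exists Q, @rei_strategy R D Q.
Proof.
have /choice[c hc] : forall r, exists p : D -> R, supp r != finset.set0 ->
    is_pmf p /\ forall y, y \notin supp r -> p y = 0.
  move=> r; have [->|/set0Pn[v vr]] := eqVneq (supp r) finset.set0.
    by exists (fun=> 0).
  exists (fun x => (x == v)%:R) => _; split; first exact: dirac_pmf.
  by move=> y; have [->|//] := eqVneq y v; rewrite vr.
by exists c.
Qed.

Lemma game_value_min r : (0 < #|D|)%N ->
  exists2 Q, rei_strategy Q & game_value R r = best_score r Q.
Proof.
move=> D0; set S := [set best_score r Q | Q in @rei_strategy R D].
have Sinf : has_inf S.
  split; last exact: best_score_lb.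
  by have [Q sQ] := ex_rei; exists (best_score r Q), Q.
have near_inf (n : nat) :
    exists2 f, rei0 f & best_score r (strat f) < inf S + n.+1%:R^-1.
  have [|_ [Q sQ <-] ltQ] := @inf_adherent R S n.+1%:R^-1 _ Sinf.
    by rewrite invr_gt0 ltr0n.
  pose f := unstrat (fun r x => if supp r == finset.set0 then 0 else Q r x).
  have Qf r' : supp r' != finset.set0 -> Q r' =1 strat f r'.
    by move=> /negPf r0 x; rewrite /strat /f /unstrat /= r0.
  exists f; last by rewrite -(eq_best_score r Qf).
  split=> [r' r0|r' r0 x]; last by rewrite /f /unstrat /= r0 eqxx.
  have [[p0 p1] psupp] := sQ r' r0.
  split; last by move=> y yr; rewrite -Qf // psupp.
  split=> [x|]; first by rewrite -Qf.
  by rewrite -p1; apply: eq_bigr => x _; rewrite Qf.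
have /choice[k kP] : forall n : nat, exists f,
    rei0 f /\ best_score r (strat f) < inf S + n.+1%:R^-1.
  by move=> n; have [f ? ?] := near_inf n; exists f.
have [f [[sf f0] clf]] : rei0 `&` cluster (k @ \oo) !=set0.
  by apply: rei0_compact; exists 0%N => // n _; exact: (kP n).1.
exists (strat f) => //; apply/eqP; rewrite eq_le; apply/andP; split.
  by apply: ge_inf; [exact: best_score_lb|exists (strat f)].
apply: ge_sup => [|_ [N sN <-]].
  have /card_gt0P[v _] := D0.
  exists (expected_score r (fun _ x => (x == v)%:R) (strat f)).
  by eexists; first exact: (ex_norman v).
apply/ler_addgt0Pr => e e0.
have cE : continuous (fun g : choices => expected_score r N (strat g)).
  apply: sum_cont => h.
  by apply: mul_cont; [exact: play_prob_contQ|exact: cst_cont].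
have : closed [set g : choices | expected_score r N (strat g) <= inf S + e].
  by apply: (preimage_closed _ (@closed_le R (inf S + e))) => g _; exact: cE.
move=> /closure_id Cid; suff : closure
    [set g : choices | expected_score r N (strat g) <= inf S + e] f.
  by rewrite -Cid.
have kE : \forall n \near \oo,
    expected_score r N (strat (k n)) <= inf S + e.
  near=> n.
  have [[sk _] ltk] := kP n.
  apply: le_trans (ub_le_sup (best_score_ub r sk) _) _; first by exists N.
  apply: ltW; apply: lt_trans ltk _; rewrite ltrD2l.
  near: n; exact: near_infty_natSinv_lt (PosNum e0).
by move=> B Bf; exact: clf kE Bf.
Unshelve. all: by end_near.
Qed.

End Attained.

(* Main.v *)
(** Rei chooses each vertex with probability proportional to the number of times
    he still has to play it.  With [t] rounds left, the proportions [r u / t] form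
    a martingale, so they stay close to the initial proportions [q u]; if they
    were equal to [q u] throughout, Norman could do no better than with a constant
    strategy.  The deviation costs Rei at most [\sum_u `|r u / t - q u|] in each
    round, and is controlled in mean square by a potential quadratic in
    [r u / t - q u].  The total loss is of the order of the square root of the
    number of rounds, hence at most of order [M `^ (2 / 3)]. *)

Require Import Defs.
From mathcomp Require Import all_boot all_order all_algebra.
From mathcomp Require Import all_classical all_reals all_analysis.
From mathcomp Require Import ring lra.
Import Order.TTheory GRing.Theory Num.Theory.
Local Open Scope classical_set_scope.
Local Open Scope ring_scope.

(** * Recursion of the expected score over the first round *)

Lemma sum_pair_tupleS {R : nmodType} {T U : finType} (n : nat)
    (F : seq (T * U) -> R) :
  \sum_(h : n.+1.-tuple (T * U)) F h =
  \sum_x \sum_y \sum_(h : n.-tuple (T * U)) F ((x, y) :: h).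
Proof.
rewrite pair_bigA pair_bigA /=.
rewrite (reindex (fun xh : T * U * n.-tuple (T * U) => cons_tuple xh.1 xh.2)) /=.
  by apply: eq_bigr => -[[x y] h].
exists (fun h : n.+1.-tuple (T * U) => (thead h, behead_tuple h)).
  by move=> [x h] _; congr (_, _); apply/val_inj.
by move=> h _; rewrite /= [RHS]tuple_eta; apply/val_inj.
Qed.

Section Play.
Context {R : realType} {D : digraph}.
Implicit Types (r : restriction D) (N Q : restriction D -> D -> R).

Lemma gain_norm_le1 (x y : D) : `|gain R x y| <= 1.
Proof.
by rewrite /gain; case: ifP => _; [|case: ifP => _]; rewrite ?normrN ?normr1 ?normr0.
Qed.

Lemma constant_scoreE r v : constant_score R r v = \sum_u gain R v u * (r u)%:R.
Proof.
rewrite /constant_score [X in X - _]big_mkcond [X in _ - X]big_mkcond /=.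
rewrite -sumrB; apply: eq_bigr => u _; rewrite /gain !finset.inE.
case: ifP => [vu|_]; last by case: ifP; rewrite ?mulN1r ?mul0r ?sub0r ?oppr0.
by rewrite (negPf (arc_asym vu)) mul1r subr0.
Qed.

Lemma remove_natr r y u : y \in supp r ->
  (remove r y u)%:R = (r u)%:R - (u == y)%:R :> R.
Proof.
rewrite finset.inE ffunE => ry; case: eqVneq => [->|_]; last by rewrite subn0 subr0.
by rewrite natrB.
Qed.

Lemma rounds_remove_supp r y : y \in supp r -> rounds r = (rounds (remove r y)).+1.
Proof.
rewrite finset.inE => ry; apply/eqP; rewrite eqn_leq rounds_remove /=.
rewrite /rounds (bigD1 y) //= [X in (_ <= X)%N](bigD1 y) //= ffunE eqxx.
rewrite (eq_bigr r) => [|u /negPf uy]; last by rewrite ffunE uy subn0.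
by rewrite -addSn leq_add2r subn1 prednK.
Qed.

Lemma rounds_supp_neq0 {r n} : rounds r = n.+1 -> supp r != finset.set0.
Proof. by move=> rn; apply: (@supp_neq0 _ r n); rewrite rn. Qed.

(** The length [n] is kept apart from [rounds r] to allow induction on it; [expected_score r] is the
    case where they agree. *)
Definition partial_score (n : nat) r N Q : R :=
  \sum_(h : n.-tuple (D * D)) play_prob N Q r h * score R h.

Lemma partial_score0 r N Q : partial_score 0 r N Q = 0.
Proof.
by rewrite /partial_score big1 // => h _; rewrite tuple0 /score big_nil mulr0.
Qed.

Lemma sum_play_prob n r N Q : norman_strategy N -> rei_strategy Q ->
  rounds r = n -> \sum_(h : n.-tuple (D * D)) play_prob N Q r h = 1.
Proof.
move=> sN sQ; elim: n r => [|n IH] r rn.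
  rewrite (big_pred1 [tuple]) // => h; symmetry; apply/eqP; exact: tuple0.
have [[_ Q1] Q0] := sQ r (rounds_supp_neq0 rn).
rewrite sum_pair_tupleS /=.
have [_ N1] := sN r; rewrite -[RHS]N1; apply: eq_bigr => x _.
rewrite -[RHS]mulr1 -[in RHS]Q1 mulr_sumr; apply: eq_bigr => y _.
rewrite -mulr_sumr; have [yr|yr] := boolP (y \in supp r); last first.
  by rewrite Q0 // mulr0 mul0r.
by rewrite IH ?mulr1 //; apply: succn_inj; rewrite -rounds_remove_supp.
Qed.

(** The first gain is common to all continuations, whose probabilities sum to 1. This recovers the
    recursive form of the score. *)
Lemma partial_scoreS n r N Q : norman_strategy N -> rei_strategy Q ->
  rounds r = n.+1 ->
  partial_score n.+1 r N Q = \sum_x N r x *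
    \sum_y Q r y * (gain R x y + partial_score n (remove r y) N Q).
Proof.
move=> sN sQ rn.
have [_ Q0] := sQ r (rounds_supp_neq0 rn).
rewrite /partial_score.
rewrite (sum_pair_tupleS _ (fun h => play_prob N Q r h * score R h)) /=.
apply: eq_bigr => x _; rewrite mulr_sumr; apply: eq_bigr => y _.
have [yr|yr] := boolP (y \in supp r); last first.
  by rewrite Q0 // mul0r mulr0 big1 // => h _; rewrite !mul0r.
have ry : rounds (remove r y) = n.
  by apply: succn_inj; rewrite -rounds_remove_supp.
rewrite -[X in X + _]mulr1 -(sum_play_prob _ _ _ _ sN sQ ry) mulr_sumr -big_split /=.
rewrite !mulr_sumr; apply: eq_bigr => h _.
by rewrite /score big_cons /=; ring.
Qed.

(** * Norman's constant strategies and the lower bound *)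

Lemma constant_strategy (v : D) : norman_strategy (fun _ x => (x == v)%:R : R).
Proof.
move=> r; split=> [x|]; first exact: ler0n.
by rewrite (bigD1 v) //= eqxx big1 ?addr0 // => i /negPf ->.
Qed.

(** Rei's order of play is irrelevant here: removing [y] lowers the constant score by exactly
    [gain R v y]. *)
Lemma partial_score_constant n r Q v : rei_strategy Q -> rounds r = n ->
  partial_score n r (fun _ x => (x == v)%:R) Q = constant_score R r v.
Proof.
move=> sQ; elim: n r => [|n IH] r rn.
  rewrite partial_score0 constant_scoreE big1 // => u _.
  by move/eqP: rn; rewrite sum_nat_eq0 => /forallP/(_ u)/eqP ->; rewrite mulr0.
rewrite partial_scoreS //; last exact: constant_strategy.
have [[_ Q1] Q0] := sQ r (rounds_supp_neq0 rn).
rewrite (bigD1 v) //= eqxx mul1r [X in _ + X]big1 ?addr0; last first.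
  by move=> x /negPf ->; rewrite mul0r.
rewrite -[RHS]mul1r -[X in _ = X * _]Q1 mulr_suml; apply: eq_bigr => y _.
have [yr|yr] := boolP (y \in supp r); last by rewrite Q0 // !mul0r.
rewrite IH; last by apply: succn_inj; rewrite -rounds_remove_supp.
congr (_ * _); rewrite !constant_scoreE.
rewrite (bigD1 y) //= [RHS](bigD1 y) //= remove_natr // eqxx.
rewrite [X in _ + (_ + X) = _](eq_bigr (fun u => gain R v u * (r u)%:R)); first by rewrite /=; ring.
by move=> u /negPf uy; rewrite remove_natr // uy subr0.
Qed.

Lemma constant_score_le_best r Q v : rei_strategy Q ->
  constant_score R r v <= best_score r Q.
Proof.
move=> sQ; rewrite -(partial_score_constant (rounds r) r Q v sQ erefl).
apply: ub_le_sup; last by eexists; [exact: (constant_strategy v)|].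
exists (score_bound R r) => _ [N sN <-].
exact: le_trans (ler_norm _) (expected_score_bound r sN sQ).
Qed.

(** * Rei's proportional strategy and the drift of the proportions *)

Definition proportional r (y : D) : R := (r y)%:R / (rounds r)%:R.

Lemma proportional_pmf r : (0 < rounds r)%N -> is_pmf (proportional r).
Proof.
move=> r0; split=> [x|]; first by rewrite divr_ge0.
by rewrite -mulr_suml -natr_sum divff // pnatr_eq0 -lt0n.
Qed.

Lemma proportional_rei : rei_strategy proportional.
Proof.
move=> r r0; split; last first.
  by move=> y; rewrite finset.inE -leqNgt leqn0 /proportional => /eqP ->; rewrite mul0r.
apply: proportional_pmf; have /set0Pn[v] := r0; rewrite finset.inE => rv.
by rewrite /rounds (bigD1 v) //= ltn_addr.
Qed.

Definition deviation (q : D -> R) r : R := \sum_u (proportional r u - q u) ^+ 2.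

Lemma deviation_ge0 q r : 0 <= deviation q r.
Proof. by apply: sumr_ge0 => u _; exact: sqr_ge0. Qed.

(* The new proportions have mean [proportional r], so only their variance is
   added. *)
Lemma mean_deviation_remove q r n : rounds r = n.+2 ->
  \sum_y proportional r y * deviation q (remove r y)
    <= deviation q r + (n.+1%:R ^+ 2)^-1.
Proof.
move=> rn; have r0 : (0 < rounds r)%N by rewrite rn.
set t : R := n.+1%:R.
have t0 : t != 0 by rewrite pnatr_eq0.
have [p0 p1] := proportional_pmf r r0.
have [_ Q0] := proportional_rei r (rounds_supp_neq0 rn).
(* Since [r u] is [t + 1] times the old proportion, dividing [r u - (u == y)] by [t] gives the
   displayed new proportion. *)
have -> : \sum_y proportional r y * deviation q (remove r y) =
    \sum_u \sum_y proportional r y *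
      (proportional r u + (proportional r u - (u == y)%:R) / t - q u) ^+ 2.
  rewrite exchange_big /=; apply: eq_bigr => y _.
  have [yr|yr] := boolP (y \in supp r); last first.
    by rewrite Q0 // mul0r big1 // => u _; rewrite mul0r.
  rewrite mulr_sumr; apply: eq_bigr => u _; congr (_ * (_ - _) ^+ 2).
  have ry : rounds (remove r y) = n.+1.
    by apply: succn_inj; rewrite -rounds_remove_supp.
  rewrite /proportional remove_natr // ry rn -(natr1 n.+1) -/t.
  by field; rewrite nat1r natr1 !pnatr_eq0.
apply: (@le_trans _ _ (\sum_u ((proportional r u - q u) ^+ 2
                               + proportional r u * (t ^+ 2)^-1))); last first.
  by rewrite big_split /= -mulr_suml p1 mul1r.
apply: ler_sum => u _; set p := proportional r u.
rewrite (bigD1 u) //= eqxx /= -/p.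
have -> : \sum_(y | y != u) proportional r y * (p + (p - (u == y)%:R) / t - q u) ^+ 2
    = (1 - p) * (p + p / t - q u) ^+ 2.
  rewrite -p1 [X in (X - p)](bigD1 u) //= -/p addrAC subrr add0r mulr_suml.
  by apply: eq_bigr => y /negPf yu; rewrite eq_sym yu subr0.
(* The increment has mean zero, so no cross term remains. The variance factor [p * (1 - p)] is then
   weakened to [p], which sums to 1 over [u]. *)
have -> : p * (p + (p - 1) / t - q u) ^+ 2 + (1 - p) * (p + p / t - q u) ^+ 2
    = (p - q u) ^+ 2 + p * (1 - p) * (t ^+ 2)^-1 by field.
rewrite lerD2l ler_wpM2r ?invr_ge0 ?sqr_ge0 // ler_piMr //; first exact: p0.
by rewrite gerBl; exact: p0.
Qed.

(** * The potential and its decrease in each round *)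

(** Weighted AM-GM: the difference of the two sides is a multiple of a square. *)
Lemma ler_norm_sqr_weight (s z : R) : 0 < s -> `|z| <= (s * z ^+ 2 + s^-1) / 2.
Proof.
move=> s0; rewrite -(real_normK (num_real z)).
have -> : (s * `|z| ^+ 2 + s^-1) / 2 = `|z| + s^-1 * (s * `|z| - 1) ^+ 2 / 2.
  by field; rewrite gt_eqF.
by rewrite lerDl divr_ge0 // mulr_ge0 ?invr_ge0 ?sqr_ge0 // ltW.
Qed.

(* With [t] rounds left, AM-GM with weight [sqrt t] bounds the expected gain by
   [m + sqrt t / 2 * deviation q r + #|D| / (2 * sqrt t)]; the coefficients below
   make the decrease of the potential in one round cover this bound and the
   variance [(t - 1)^-2] of the next proportions. *)
Definition potential (m : R) (q : D -> R) r : R :=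
  let t := (rounds r)%:R in
  t * m + Num.sqrt t * t / 2 * deviation q r + (#|D|%:R + 2) * Num.sqrt t.

(** Against [q], the choice [x] gains at most [m]; as gains are at most 1 in absolute value, passing
    to the current proportions costs at most the sum of their absolute deviations. *)
Lemma proportional_gain_le m q r x : (0 < rounds r)%N ->
  \sum_u gain R x u * q u <= m ->
  \sum_y proportional r y * gain R x y <=
    m + Num.sqrt (rounds r)%:R / 2 * deviation q r
      + #|D|%:R / (2 * Num.sqrt (rounds r)%:R).
Proof.
move=> r0 qm; set s : R := Num.sqrt _.
have s0 : 0 < s by rewrite sqrtr_gt0 ltr0n.
rewrite -addrA.
have -> : s / 2 * deviation q r + #|D|%:R / (2 * s) =
    \sum_u (s * (proportional r u - q u) ^+ 2 + s^-1) / 2.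
  rewrite -mulr_suml big_split /= -mulr_sumr sumr_const -/(deviation q r).
  by rewrite -[_ *+ #|_|]mulr_natr; field; rewrite gt_eqF.
apply: le_trans (lerD qm (lexx _)); rewrite -big_split /=; apply: ler_sum => u _.
rewrite addrC -lerBlDr mulrC -mulrBr.
apply: le_trans (ler_norm_sqr_weight _ (proportional r u - q u) s0).
by apply: le_trans (ler_norm _) _; rewrite normrM ler_piMl ?gain_norm_le1.
Qed.

(** The growth of the last term of [potential] pays for the AM-GM remainder and for the variance:
    with [a] and [b] the two roots, [b - a = (a + b)^-1] is at least [b^-1 / 2], and
    [b <= 2 * a]. *)
Lemma sqrt_increment (k : R) (n : nat) : 0 <= k ->
  k / (2 * Num.sqrt n.+2%:R) + (2 * Num.sqrt n.+1%:R)^-1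
    + (k + 2) * Num.sqrt n.+1%:R <= (k + 2) * Num.sqrt n.+2%:R.
Proof.
move=> k0; set a : R := Num.sqrt n.+1%:R; set b : R := Num.sqrt n.+2%:R.
have a0 : 0 < a by rewrite sqrtr_gt0.
have b0 : 0 < b by rewrite sqrtr_gt0.
have a2 : a ^+ 2 = n.+1%:R by rewrite sqr_sqrtr.
have b2 : b ^+ 2 = a ^+ 2 + 1 by rewrite a2 sqr_sqrtr // natr1.
have a1 : 1 <= a ^+ 2 by rewrite a2 ler1n.
have ab : a <= b by rewrite ler_sqrt // ler_nat.
have ba : b <= 2 * a by rewrite -(ler_pXn2r (n := 2)) ?nnegrE ?ltW ?mulr_gt0 //; nra.
have inv_ab : a^-1 <= 2 * b^-1.
  by rewrite ler_pdivlMr // ler_pdivrMl // mulrC.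
have step : b^-1 / 2 <= b - a.
  rewrite -invfM (_ : b - a = (a + b)^-1); last first.
    apply: (mulIf (x := a + b)); first by rewrite gt_eqF ?addr_gt0.
    rewrite mulVf ?gt_eqF ?addr_gt0 // -[1](addrK (a ^+ 2)) (addrC 1) -b2.
    by ring.
  rewrite lef_pV2 ?posrE ?addr_gt0 ?mulr_gt0 //; nra.
by rewrite !invfM; nra.
Qed.

(** Whatever Norman chooses, the potential loses on average at least the expected gain. *)
Lemma potential_step m q r x n : rounds r = n.+1 ->
  \sum_u gain R x u * q u <= m ->
  \sum_y proportional r y * (gain R x y + potential m q (remove r y))
    <= potential m q r.
Proof.
move=> rn qm; have r0 : (0 < rounds r)%N by rewrite rn.
have := proportional_gain_le m q r x r0 qm.
have [p0 p1] := proportional_pmf r r0.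
have [_ Q0] := proportional_rei r (supp_neq0 r0).
set k : R := #|D|%:R; have k0 : 0 <= k by [].
have -> : \sum_y proportional r y * (gain R x y + potential m q (remove r y)) =
    \sum_y proportional r y * gain R x y
    + (n%:R * m + Num.sqrt n%:R * n%:R / 2 *
         (\sum_y proportional r y * deviation q (remove r y))
       + (k + 2) * Num.sqrt n%:R).
  transitivity (\sum_y (proportional r y * gain R x y + (proportional r y *
      (n%:R * m + (k + 2) * Num.sqrt n%:R) + Num.sqrt n%:R * n%:R / 2 *
      (proportional r y * deviation q (remove r y))))).
    apply: eq_bigr => y _; have [yr|yr] := boolP (y \in supp r); last first.
      by rewrite Q0 // !mul0r !add0r mulr0.
    have ry : rounds (remove r y) = n.
      by apply: succn_inj; rewrite -rounds_remove_supp.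
    by rewrite /potential ry -/k; ring.
  by rewrite !big_split /= -mulr_suml p1 -mulr_sumr; ring.
have := deviation_ge0 q r.
rewrite /potential rn -/k; set S := deviation q r.
set G := \sum_y _ * gain R x y.
(* In the last round no proportions remain to be compared; their coefficient is 0. *)
case: n rn => [|n] rn S0 GS; first by move: GS; rewrite sqrtr0 sqrtr1; lra.
have := mean_deviation_remove q r n rn; have := sqrt_increment k n k0.
move: GS; set X := \sum_y _; rewrite -/S.
rewrite -(natr1 n.+1); set t : R := n.+1%:R.
set a := Num.sqrt t; set b := Num.sqrt (t + 1) => GS incr dev.
have t0 : 0 < t by rewrite ltr0n.
have a0 : 0 < a by rewrite sqrtr_gt0.
have a2 : t = a ^+ 2 by rewrite sqr_sqrtr // ltW.
have ab : a <= b by rewrite ler_sqrt ?lerDl ?addr_ge0 // ltW.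
have at0 : 0 <= a * t / 2 by rewrite !mulr_ge0 // ltW.
have := ler_wpM2l at0 dev.
have -> : a * t / 2 * (S + t ^- 2) = a * t / 2 * S + (2 * a)^-1.
  by rewrite a2; field; rewrite gt_eqF.
(* The coefficients of [S] fit: [a * t / 2] from the next potential and [b / 2] from the gain add up
   to at most [b * (t + 1) / 2]. *)
have tS : 0 <= t * S by rewrite mulr_ge0 // ltW.
have := ler_wpM2r tS ab.
lra.
Qed.

Lemma partial_score_le_potential m q n r N : norman_strategy N ->
  (forall x, \sum_u gain R x u * q u <= m) -> rounds r = n ->
  partial_score n r N proportional <= potential m q r.
Proof.
move=> sN qm; elim: n r => [|n IH] r rn.
  by rewrite partial_score0 /potential rn sqrtr0 !(mul0r, mulr0) !addr0.
rewrite partial_scoreS //; last exact: proportional_rei.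
have [N0 N1] := sN r; rewrite -[leRHS]mul1r -N1 mulr_suml.
apply: ler_sum => x _; apply: ler_wpM2l; first exact: N0.
apply: le_trans (potential_step m q r x n rn (qm x)).
have [p0 _] := proportional_pmf r ltac:(by rewrite rn).
have [_ Q0] := proportional_rei r (rounds_supp_neq0 rn).
apply: ler_sum => y _; have [yr|yr] := boolP (y \in supp r); last first.
  by rewrite Q0 // !mul0r.
rewrite ler_wpM2l // lerD2l; apply: IH.
by apply: succn_inj; rewrite -rounds_remove_supp.
Qed.

(** * Comparison with the best constant score and with [M] *)

Lemma constant_score_le_sup r v :
  constant_score R r v <= sup (range (constant_score R r)).
Proof.
apply: ub_le_sup; last by exists v.
exists (best_score r proportional) => _ [u _ <-].
exact: constant_score_le_best proportional_rei.
Qed.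

(** With [q] the initial proportions, the deviation in the initial potential vanishes. *)
Lemma proportional_score_le r N : (0 < #|D|)%N -> norman_strategy N ->
  expected_score r N proportional <=
  sup (range (constant_score R r)) + (#|D|%:R + 2) * Num.sqrt (rounds r)%:R.
Proof.
move=> /card_gt0P[v _] sN; set m := sup _.
have qm x : \sum_u gain R x u * proportional r u <= m / (rounds r)%:R.
  have -> : \sum_u gain R x u * proportional r u =
      constant_score R r x / (rounds r)%:R.
    by rewrite constant_scoreE mulr_suml; apply: eq_bigr => u _; rewrite mulrA.
  by rewrite ler_wpM2r // constant_score_le_sup.
apply: le_trans (partial_score_le_potential _ _ _ _ _ sN qm erefl) _.
rewrite /potential /deviation [X in _ / 2 * X]big1 ?mulr0 ?addr0; last first.
  by move=> u _; rewrite subrr expr0n.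
rewrite lerD2r; have [r0|r0] := eqVneq (rounds r) 0%N; last first.
  by rewrite mulrCA divff ?mulr1 // pnatr_eq0.
(* With no rounds, [m / 0 = 0], so [0 <= m] is needed; the constant score of [v] is then 0. *)
rewrite r0 mul0r; apply: le_trans (constant_score_le_sup r v).
by rewrite -(partial_score_constant 0 r _ v proportional_rei r0) partial_score0.
Qed.

(** There are at most [#|D| * M] rounds, and [M] to the power 1/2 is at most [M] to the power 2/3
    once [M >= 1]; hence the separate case [M = 0]. *)
Lemma sqrt_rounds_le r :
  Num.sqrt (rounds r)%:R <=
  (#|D|%:R + 1) * (\max_(v : D) r v)%N%:R `^ (2%:R / 3%:R) :> R.
Proof.
set M := (\max_v r v)%N; set k : R := #|D|%:R; have k0 : 0 <= k by [].
have rM : (rounds r <= #|D| * M)%N.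
  rewrite -sum_nat_const; apply: leq_sum => u _.
  exact: (leq_bigmax (F := fun v => r v)).
have [M0|M0] := posnP M.
  by move: rM; rewrite M0 muln0 leqn0 => /eqP ->; rewrite sqrtr0 mulr_ge0 ?powR_ge0 ?addr_ge0.
have k1 : Num.sqrt k <= k + 1.
  rewrite -[leRHS]ger0_norm ?addr_ge0 // -sqrtr_sqr ler_sqrt ?sqr_ge0 //; nra.
apply: (@le_trans _ _ (Num.sqrt (k * M%:R))).
  by rewrite ler_sqrt ?mulr_ge0 // -natrM ler_nat.
rewrite sqrtrM //; apply: ler_pM; rewrite ?sqrtr_ge0 //.
rewrite -powR12_sqrt // ler_powR ?ler1n //; lra.
Qed.

End Play.

Theorem theorem1p3 (R : realType) (D : digraph) :
  exists C : R, 0 < C /\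
    forall r : restriction D,
      sup (range (constant_score R r)) <= game_value R r /\
      game_value R r <=
        sup (range (constant_score R r))
        + C * (\max_(v : D) r v)%N%:R `^ (2%:R / 3%:R).
Proof.
(* The factors come from [potential] and from [sqrt_rounds_le]. *)
exists ((#|D|%:R + 2) * (#|D|%:R + 1)); split=> [|r].
  by rewrite mulr_gt0 // ltr_wpDl.
(* Without vertices Norman has no strategy, and the convention that the supremum of the empty set is
   0 makes every quantity 0. *)
have [D0|D0] := posnP #|D|.
  have noD (v : D) : False by have := card0_eq D0 v; rewrite inE.
  have -> : range (constant_score R r) = set0.
    by apply/seteqP; split=> // z [v].
  have best0 Q : best_score r Q = 0 :> R.
    rewrite /best_score (_ : [set _ | _ in _] = set0) ?sup0 //.
    apply/seteqP; split=> // z [N sN]; have [_] := sN r.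
    by rewrite big1 => [/esym/eqP|x]; [rewrite oner_eq0|case: (noD x)].
  have -> : game_value R r = 0.
    rewrite /game_value (_ : [set _ | _ in _] = [set 0]) ?inf1 //.
    apply/seteqP; split=> z /= => [[Q sQ <-]//|->].
    by have [Q sQ] := ex_rei R D; exists Q.
  by rewrite sup0 add0r; split.
have /card_gt0P[v _] := D0.
split.
  have [Q sQ ->] := @game_value_min R D r D0.
  apply: ge_sup => [|_ [u _ <-]]; first by exists (constant_score R r v), v.
  exact: constant_score_le_best.
apply: (@le_trans _ _ (best_score r (@proportional R D))).
  apply: ge_inf; last by exists (@proportional R D) => //; exact: proportional_rei.
  by exists (constant_score R r v) => _ [Q sQ <-]; exact: constant_score_le_best.
have [N sN ->] := best_score_max r (@proportional R D) D0.
apply: le_trans (proportional_score_le r N D0 sN) _.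
by rewrite lerD2l -mulrA ler_wpM2l ?addr_ge0 // sqrt_rounds_le.
Qed.
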